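(* Let $R$ be a (Krasner) hyperring. Every primitive hyperideal of $R$ is a prime hyperideal of $R$.
   Context: For a nonempty set $H$, $\mathcal P^*(H)$ is the set of nonempty subsets of $H$. A canonical hypergroup $(H,+,0)$ is a nonempty set $H$ with a hyperoperation $+\colon H\times H\to\mathcal P^*(H)$ and $0\in H$ (with $A+B=\bigcup_{a\in A,b\in B}(a+b)$ for subsets, and elements identified with singletons) such that for all $a,b,c\in H$: $a+b=b+a$; $a+(b+c)=(a+b)+c$; $a+0=\{a\}$; there is a unique $-a\in H$ with $0\in a-a:=a+(-a)$; and $a\in b+c$ implies $c\in -b+a$ and $b\in a-c$. A (Krasner) hyperring $R$ is a canonical hypergroup $(R,+,0)$ with an associative binary (single-valued) multiplication such that $a0=0a=0$, $a(b+c)=ab+ac$, $(a+b)c=ac+bc$; a multiplicative identity and commutativity are not assumed. A subhypergroup is a nonempty subset $S$ with $x-y\subseteq S$ for all $x,y\in S$. A hyperideal of $R$ is a subhypergroup $\mathfrak a$ with $ra\in\mathfrak a$ and $ar\in\mathfrak a$ for all $r\in R$, $a\in\mathfrak a$. For hyperideals $\mathfrak a,\mathfrak b$, $\mathfrak a\mathfrak b=\{x\mid x\in\sum_{i=1}^n a_ib_i,\ a_i\in\mathfrak a,\ b_i\in\mathfrak b,\ n\ge 1\}$. A proper hyperideal $\mathfrak p$ is prime if for all hyperideals $\mathfrak a,\mathfrak b$ of $R$, $\mathfrak a\mathfrak b\subseteq\mathfrak p$ implies $\mathfrak a\subseteq\mathfrak p$ or $\mathfrak b\subseteq\mathfrak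 p$. A (right) $R$-hypermodule is a canonical hypergroup $M$ with a map $M\times R\to M$, $(m,r)\mapsto mr$, such that $(m+m')r=mr+m'r$, $m(r+r')=mr+mr'$, $m(rr')=(mr)r'$, $m0=0$. A subhypermodule is a subhypergroup $S$ of $M$ with $sr\in S$ for all $s\in S$, $r\in R$. $M$ is simple if $MR\neq 0$ (i.e. $mr\ne0$ for some $m\in M,r\in R$) and its only subhypermodules are $0$ and $M$. $\mathtt{Ann}_R(M)=\{r\in R\mid mr=0\text{ for all }m\in M\}$. A proper hyperideal of $R$ is primitive if it equals $\mathtt{Ann}_R(M)$ for some simple $R$-hypermodule $M$. *)

(* Defs.v *)
From HB Require Import structures.
From mathcomp Require Import all_boot.
From mathcomp Require Import boolp classical_sets.

Set Implicit Arguments.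
Unset Strict Implicit.
Unset Printing Implicit Defensive.

Local Open Scope classical_set_scope.

Definition lift_hyperop (T : Type) (op : T -> T -> set T) (A B : set T) : set T :=
  \bigcup_(a in A) \bigcup_(b in B) op a b.

(* The opposite is recorded as an operation; [hadd_oppr] and [hopp_uniq] say
   that [hopp a] is the unique b with 0 \in a + b. *)
HB.mixin Record isCanonicalHypergroup (H : Type) := {
  hzero : H;
  hopp : H -> H;
  hadd : H -> H -> set H;
  hadd_neq0 : forall a b, hadd a b !=set0;
  haddC : forall a b, hadd a b = hadd b a;
  haddA : forall a b c,
    lift_hyperop hadd [set a] (hadd b c) = lift_hyperop hadd (hadd a b) [set c];
  hadd0 : forall a, hadd a hzero = [set a];
  hadd_oppr : forall a, hadd a (hopp a) hzero;
  hopp_uniq : forall a b, hadd a b hzero -> b = hopp a;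
  hadd_revl : forall a b c, hadd b c a -> hadd (hopp b) a c;
  hadd_revr : forall a b c, hadd b c a -> hadd a (hopp c) b
}.

#[short(type="canonicalHypergroupType")]
HB.structure Definition CanonicalHypergroup := { H of isCanonicalHypergroup H }.

Arguments hzero {s}.

HB.mixin Record CanonicalHypergroup_isHyperring R
    of isCanonicalHypergroup R := {
  hmul : R -> R -> R;
  hmulA : forall a b c, hmul a (hmul b c) = hmul (hmul a b) c;
  hmulr0 : forall a, hmul a hzero = hzero;
  hmul0r : forall a, hmul hzero a = hzero;
  hmulDr : forall a b c : R,
    hmul a @` hadd b c = hadd (hmul a b) (hmul a c);
  hmulDl : forall a b c : R,
    hmul^~ c @` hadd a b = hadd (hmul a c) (hmul b c)
}.

#[short(type="hyperringType")]
HB.structure Definition Hyperring :=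
  { R of CanonicalHypergroup_isHyperring R & isCanonicalHypergroup R }.

HB.mixin Record CanonicalHypergroup_isRightHypermodule (R : hyperringType) M
    of isCanonicalHypergroup M := {
  hact : M -> R -> M;
  hactDl : forall (m m' : M) (r : R),
    hact^~ r @` hadd m m' = hadd (hact m r) (hact m' r);
  hactDr : forall (m : M) (r r' : R),
    hact m @` hadd r r' = hadd (hact m r) (hact m r');
  hactA : forall (m : M) (r r' : R), hact m (hmul r r') = hact (hact m r) r';
  hact0 : forall m : M, hact m hzero = hzero
}.

#[short(type="hypermoduleType")]
HB.structure Definition RightHypermodule (R : hyperringType) :=
  { M of CanonicalHypergroup_isRightHypermodule R M & isCanonicalHypergroup M }.

Definition subhypergroup (H : canonicalHypergroupType) (S : set H) : Prop :=
  S !=set0 /\ forall x y, S x -> S y -> hadd x (hopp y) `<=` S.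

Definition hyperideal (R : hyperringType) (I : set R) : Prop :=
  subhypergroup I /\ forall r a, I a -> I (hmul r a) /\ I (hmul a r).

Definition proper_hyperideal (R : hyperringType) (I : set R) : Prop :=
  hyperideal I /\ I <> setT.

(* Hypersums are associated to the right and end with a harmless summand 0,
   since x + 0 = {x}. *)
Definition hyperideal_mul (R : hyperringType) (I J : set R) : set R :=
  [set x | exists (n : nat) (a b : 'I_n -> R),
    [/\ (0 < n)%N, forall i, I (a i), forall i, J (b i) &
        (\big[lift_hyperop hadd/[set hzero]]_(i < n) [set hmul (a i) (b i)]) x]].

Definition prime_hyperideal (R : hyperringType) (P : set R) : Prop :=
  proper_hyperideal P /\
  forall I J : set R, hyperideal I -> hyperideal J ->
    hyperideal_mul I J `<=` P -> I `<=` P \/ J `<=` P.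

Definition subhypermodule (R : hyperringType) (M : hypermoduleType R)
    (S : set M) : Prop :=
  subhypergroup S /\ forall (s : M) (r : R), S s -> S (hact s r).

Definition simple_hypermodule (R : hyperringType) (M : hypermoduleType R) : Prop :=
  (exists (m : M) (r : R), hact m r <> hzero) /\
  forall S : set M, subhypermodule S -> S = [set hzero] \/ S = setT.

Definition hyperann (R : hyperringType) (M : hypermoduleType R) : set R :=
  [set r | forall m : M, hact m r = hzero].

Definition primitive_hyperideal (R : hyperringType) (P : set R) : Prop :=
  proper_hyperideal P /\
  exists M : hypermoduleType R, simple_hypermodule M /\ P = hyperann M.

(* Main.v *)
Require Import Defs.
From mathcomp Require Import all_boot.
From mathcomp Require Import boolp classical_sets.

(** Let P = Ann(M) with M simple and IJ contained in P. The annihilator of J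
    in M is a subhypermodule, hence 0 or M. If it is M then J is contained in P;
    if it is 0 then MI = 0, because MI is killed by J, so I is contained in P. *)

Lemma hopp0 (H : canonicalHypergroupType) : hopp hzero = hzero :> H.
Proof. by symmetry; apply: hopp_uniq; rewrite hadd0. Qed.

(** Since [0 = 0 0] in [M], associativity gives [0 r = (0 0) r = 0 (0 r) = 0 0 = 0]. *)
Lemma hact0r (R : hyperringType) (M : hypermoduleType R) (r : R) :
  hact (hzero : M) r = hzero.
Proof. by rewrite -{1}(hact0 (hzero : M)) -hactA hmul0r hact0. Qed.

(** From [0] in [m + (-m)], distributivity puts [0 r = 0] in [m r + (-m) r]; opposites are
    unique. *)
Lemma hactN (R : hyperringType) (M : hypermoduleType R) (m : M) (r : R) :
  hact (hopp m) r = hopp (hact m r).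
Proof.
apply: hopp_uniq; rewrite -hactDl.
by exists hzero; [exact: hadd_oppr | exact: hact0r].
Qed.

Lemma hyperideal_mul_mem (R : hyperringType) (I J : set R) (a b : R) :
  I a -> J b -> hyperideal_mul I J (hmul a b).
Proof.
move=> Ia Jb; exists 1, (fun=> a), (fun=> b); split=> //.
rewrite big_ord_recl big_ord0.
(* The one-term sum still carries the final summand [0]. *)
by exists (hmul a b) => //; exists hzero => //; rewrite hadd0.
Qed.

Definition module_ann (R : hyperringType) (M : hypermoduleType R) (J : set R) :
  set M := [set m | forall b, J b -> hact m b = hzero]%classic.

Lemma subhypermodule_module_ann (R : hyperringType) (M : hypermoduleType R)
  (J : set R) : hyperideal J -> subhypermodule (module_ann R M J).
Proof.
move=> [_ Jideal]; split; last first.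
  (* [(s r) b = s (r b)] with [r b] in [J]. *)
  by move=> s r Ss b Jb; rewrite -hactA; apply: Ss; exact: (Jideal r b Jb).1.
split; first by exists hzero => b _; exact: hact0r.
move=> x y Sx Sy z xyz b Jb.
(* [z b] lies in [x b - y b = 0 - 0 = {0}]. *)
have : hadd (hact x b) (hact (hopp y) b) (hact z b).
  by rewrite -hactDl; exists z.
by rewrite hactN Sx// Sy// hopp0 hadd0.
Qed.

Theorem proposition3p6 (R : hyperringType) (P : set R)
  (hP : primitive_hyperideal P) : prime_hyperideal P.
Proof.
case: hP => Pproper [M [[_ Msimple] PE]]; split=> // I J _ Jideal IJP.
case: (Msimple _ (subhypermodule_module_ann R M J Jideal)) => annE.
- left=> a Ia; rewrite PE => m.
  have : module_ann R M J (hact m a).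
    (* [(m a) b = m (a b)], where [a b] is in [IJ], hence in [P], which annihilates [M]. *)
    move=> b Jb; rewrite -hactA.
    by have := IJP _ (hyperideal_mul_mem _ _ _ _ _ Ia Jb); rewrite PE; exact.
  by rewrite annE.
- right=> b Jb; rewrite PE => m.
  have : module_ann R M J m by rewrite annE.
  exact.
Qed.
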